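(* The system of four first-order differential equations $$2(A_1)_t=A_2\,\omega-\cot\left(\tfrac p2\right)A_1A_3\,\omega,\qquad 2(A_2)_t=-A_1\,\omega-\cot\left(\tfrac p2\right)A_2A_3\,\omega,$$ $$2(A_3)_t=-\cot\left(\tfrac p2\right)(A_3^2-1)\,\omega,\qquad p_t=A_3\,\omega$$ admits the following general analytical solution: $$A_1(s,t)=-\frac{\sqrt{C}\,\sin\left(\frac12\omega(C_2-t)\right)}{\sqrt{\omega^2\cos^2\left(\frac12\omega(C_1-t)\right)+C\sin^2\left(\frac12\omega(C_1-t)\right)}},$$ $$A_2(s,t)=\frac{\sqrt{C}\,\cos\left(\frac12\omega(C_2-t)\right)}{\sqrt{\omega^2\cos^2\left(\frac12\omega(C_1-t)\right)+C\sin^2\left(\frac12\omega(C_1-t)\right)}},$$ $$A_3(s,t)=\frac{\sqrt{\omega^2-C}\,\cos\left(\frac12\omega(C_1-t)\right)}{\sqrt{\omega^2\cos^2\left(\frac12\omega(C_1-t)\right)+C\sin^2\left(\frac12\omega(C_1-t)\right)}},$$ $$p(s,t)=2\arccos\left(\frac{\sqrt{\omega^2-C}\,\sin\left(\frac12\omega(C_1-t)\right)}{\omega}\right),$$ where $C,C_1,C_2$ are functions of $s$, determined by the initial data at time $t_0$ as follows: $$C(s):=\omega^2\left(1-A_3^2(s,t_0)\right)\sin^2\left(\frac{p(s,t_0)}{2}\right),$$ $$C_1(s):=t_0+\frac{A_3(s,t_0)\,|\sin(p(s,t_0))|}{\sqrt{\omega^2-C(s)}},$$ $$C_2(s):=t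_0+\frac{2}{\omega}\arctan\left(\frac{A_1(s,t_0)}{A_2(s,t_0)}\right).$$
   Context: The system arises as follows. A vector function $\vec p(s,t)=p\,\vec e\in\mathbb{R}^3$, with $p=|\vec p|$ and $\vec e$ a unit vector, satisfies $p_t=\vec e\cdot\vec\omega$ and $2\vec e_t=\vec e\times\vec\omega-\cot(p/2)\,\vec e\times(\vec e\times\vec\omega)$, where $s$ is the arc-length parameter of a rod, $t$ is time, and $\vec\omega$ is the twist vector function of the rod. The vector $\vec\omega$ is assumed to be independent of $t$ on the time interval $\Delta t$ considered, and a Cartesian coordinate system $\vec e_1,\vec e_2,\vec e_3$ is chosen with $\vec e_3$ parallel to $\vec\omega$, so that $\vec\omega=\omega\,\vec e_3$ with $\omega=\sqrt{\omega_1^2+\omega_2^2+\omega_3^2}$ (where $\omega_1,\omega_2,\omega_3$ are the components of $\vec\omega$), and $\vec e=A_1\vec e_1+A_2\vec e_2+A_3\vec e_3$. The subscript $t$ on $A_i$, $p$ and $\vec e$ denotes differentiation with respect to time, and $t_0$ is the initial time.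
   Formalization: The printed C1, C2 do not reproduce the initial data; the general solution is proved with ω(C2−t0)/2 = arg(A2−iA1) and ω(C1−t0)/2 = arg(A3 sin(p/2)+i cos(p/2)) at t0, for unit e, ω>0, 0<p<2π, the formulas solving the system where the denominator is nonzero. *)

(* Defs.v *)
(* Real analysis over the Stdlib reals; derivatives are Coquelicot's. *)
From Stdlib Require Import Reals.
From Coquelicot Require Import Coquelicot.
Open Scope R_scope.

Definition cot (x : R) : R := cos x / sin x.

(* [w1], [w2], [w3] are the components of the twist vector as functions of the
   arc length; they do not depend on time. *)
Definition twist_norm (w1 w2 w3 : R -> R) (s : R) : R :=
  sqrt (w1 s ^ 2 + w2 s ^ 2 + w3 s ^ 2).

(* The system at time [t], for a fixed arc length [s].  [Derive] is a total
   function, hence the explicit differentiability requirements. *)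
Definition cosserat_system (omega : R) (A1 A2 A3 p : R -> R) (t : R) : Prop :=
  (ex_derive A1 t /\ ex_derive A2 t /\ ex_derive A3 t /\ ex_derive p t) /\
  2 * Derive A1 t = A2 t * omega - cot (p t / 2) * A1 t * A3 t * omega /\
  2 * Derive A2 t = - A1 t * omega - cot (p t / 2) * A2 t * A3 t * omega /\
  2 * Derive A3 t = - cot (p t / 2) * (A3 t ^ 2 - 1) * omega /\
  Derive p t = A3 t * omega.

(* (A1, A2, A3) is a unit vector, and the angle [p] lies on the branch
   0 < p < 2 pi of cot (p / 2), the one containing the values of 2 arccos. *)
Definition admissible (A1 A2 A3 p : R) : Prop :=
  A1 ^ 2 + A2 ^ 2 + A3 ^ 2 = 1 /\ 0 < p < 2 * PI.

Definition den (omega C C1 t : R) : R :=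
  omega ^ 2 * cos (/ 2 * omega * (C1 - t)) ^ 2
  + C * sin (/ 2 * omega * (C1 - t)) ^ 2.

Definition sol_A1 (omega C C1 C2 t : R) : R :=
  - (sqrt C * sin (/ 2 * omega * (C2 - t)) / sqrt (den omega C C1 t)).

Definition sol_A2 (omega C C1 C2 t : R) : R :=
  sqrt C * cos (/ 2 * omega * (C2 - t)) / sqrt (den omega C C1 t).

Definition sol_A3 (omega C C1 t : R) : R :=
  sqrt (omega ^ 2 - C) * cos (/ 2 * omega * (C1 - t)) / sqrt (den omega C C1 t).

Definition sol_p (omega C C1 t : R) : R :=
  2 * acos (sqrt (omega ^ 2 - C) * sin (/ 2 * omega * (C1 - t)) / omega).

(* In the following definitions [a1], [a2], [a3], [p0] are the values of
   A1, A2, A3, p at the initial time. *)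
Definition const_C (omega a3 p0 : R) : R :=
  omega ^ 2 * (1 - a3 ^ 2) * sin (p0 / 2) ^ 2.

(* The values printed in the source.  With them the formulas above solve the
   system, but in general do not take the given initial values at [t0]. *)
Definition printed_C1 (omega t0 a3 p0 : R) : R :=
  t0 + a3 * Rabs (sin p0) / sqrt (omega ^ 2 - const_C omega a3 p0).

Definition printed_C2 (omega t0 a1 a2 : R) : R :=
  t0 + 2 / omega * atan (a1 / a2).

(* An argument of the complex number x + i y, for (x, y) <> (0, 0). *)
Definition polar_angle (x y : R) : R :=
  if Rlt_dec 0 x then atan (y / x)
  else if Rlt_dec x 0 then atan (y / x) + PI
  else if Rle_dec 0 y then PI / 2 else - (PI / 2).

(* The values for which the formulas do take the given initial values: with
   th_i = omega (C_i - t0) / 2, the formulas at [t0] say that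
   (cos th_1, sin th_1) is proportional to (a3 sin (p0/2), cos (p0/2)) and
   (cos th_2, sin th_2) to (a2, - a1), with nonnegative factors. *)
Definition init_C1 (omega t0 a3 p0 : R) : R :=
  t0 + 2 / omega * polar_angle (a3 * sin (p0 / 2)) (cos (p0 / 2)).

Definition init_C2 (omega t0 a1 a2 : R) : R :=
  t0 + 2 / omega * polar_angle a2 (- a1).

(* Main.v *)
Require Import Defs.
From Stdlib Require Import Reals Lra.
From Coquelicot Require Import Coquelicot.
Open Scope R_scope.

(** The system is a rotation in disguise.  Put [q0 = cos (p / 2)] and
    [qi = sin (p / 2) * Ai]: these are the components of the unit quaternion of
    the rotation by the angle [p] about the axis [(A1, A2, A3)].  With
    [k = omega / 2] the four nonlinear equations become the two decoupled linear
    ones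
      [q1' = k q2, q2' = - k q1]   and   [q3' = k q0, q0' = - k q3]
    ([linear_of_system], and conversely [system_of_linear]).  Each pair turns
    with constant angular velocity, so its solution has a constant radius and a
    linear phase.  The radii are [sqrt C / omega] for [(q1, q2)] and
    [sqrt (omega ^ 2 - C) / omega] for [(q3, q0)], and [C1], [C2] encode the
    phases.

    On the branch [0 < p < 2 PI] one has [sin (p / 2) = sqrt (1 - q0 ^ 2) > 0],
    hence [p = 2 acos q0] and [Ai = qi / sqrt (1 - q0 ^ 2)]; these are the stated
    formulas because [den = omega ^ 2 * (1 - q0 ^ 2)] ([sol_of_sol_q]).  That
    they solve the system holds for all [C], [C1], [C2] with
    [0 <= C <= omega ^ 2], in particular for those computed from initial data by
    [const_C], [printed_C1], [printed_C2].

    Conversely, any solution on an interval gives a solution of the linear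
    system, which is determined by its values at [t0] ([rotation_unique]); the
    polar coordinates of these values are the radii and phases given by
    [const_C], [init_C1], [init_C2] ([sol_q_from_initial]). *)

(** * Functions on an interval *)

Lemma continuous_on_Rplus (T : R -> Prop) (f g : R -> R) :
  continuous_on T f -> continuous_on T g -> continuous_on T (fun t => f t + g t).
Proof.
  intros Hf Hg t Ht.
  apply (filterlim_comp_2 f g Rplus (Hf t Ht) (Hg t Ht)).
  exact (filterlim_plus (V := R_NormedModule) (f t) (g t)).
Qed.

Lemma continuous_on_Rmult (T : R -> Prop) (f g : R -> R) :
  continuous_on T f -> continuous_on T g -> continuous_on T (fun t => f t * g t).
Proof.
  intros Hf Hg t Ht.
  apply (filterlim_comp_2 f g Rmult (Hf t Ht) (Hg t Ht)).
  exact (filterlim_mult (K := R_AbsRing) (f t) (g t)).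
Qed.

Lemma continuous_on_comp (T : R -> Prop) (f F : R -> R) :
  continuous_on T f -> (forall y, ex_derive F y) ->
  continuous_on T (fun t => F (f t)).
Proof.
  intros Hf HF t Ht.
  eapply filterlim_comp; [exact (Hf t Ht)|].
  exact (ex_derive_continuous F (f t) (HF (f t))).
Qed.

Lemma differentiable_continuous_on (T : R -> Prop) (F : R -> R) :
  (forall t, ex_derive F t) -> continuous_on T F.
Proof.
  intros HF. apply continuous_on_forall. intros t _.
  exact (ex_derive_continuous F t (HF t)).
Qed.

(** The mean value theorem needs two-sided continuity at the end points, where
    [f] is only continuous within [T].  Precomposing [f] with the retraction of
    the line onto [[a, b]] provides it and changes nothing inside. *)
Lemma constant_on_interval (T : R -> Prop) (f : R -> R) :
  (forall x y z, T x -> T z -> x <= y <= z -> T y) ->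
  continuous_on T f ->
  (forall t, locally t T -> is_derive f t 0) ->
  forall a b, T a -> T b -> f a = f b.
Proof.
  intros HT Hc Hd.
  assert (H : forall a b, T a -> T b -> a < b -> f a = f b).
  { intros a b Ha Hb Hab.
    set (r := fun y => Rmax a (Rmin b y)).
    assert (Hin : forall y, a <= y <= b -> r y = y).
    { intros y Hy. unfold r. rewrite Rmin_right, Rmax_right; lra. }
    assert (HrT : forall y, T (r y)).
    { intros y. apply (HT a _ b Ha Hb). unfold r, Rmax, Rmin.
      destruct (Rle_dec b y); destruct (Rle_dec a _); lra. }
    destruct (MVT_gen (fun y => f (r y)) a b (fun _ => 0)) as [c [_ Hm]].
    - rewrite Rmin_left, Rmax_right by lra. intros y Hy.
      apply is_derive_ext_loc with f.
      + apply (locally_interval _ y a b); simpl; try lra.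
        intros z Hz1 Hz2; simpl in *. rewrite Hin; [reflexivity | lra].
      + apply Hd. apply (locally_interval _ y a b); simpl; try lra.
        intros z Hz1 Hz2; simpl in *. apply (HT a z b Ha Hb); lra.
    - intros y _. apply continuity_pt_filterlim.
      eapply filterlim_comp; [|exact (Hc (r y) (HrT y))].
      intros P [eps HP]. exists eps. intros z Hz.
      apply HP; [|apply HrT].
      (* the retraction does not increase distances *)
      eapply Rle_lt_trans; [|exact Hz].
      unfold abs, minus, plus, opp, r, Rmax, Rmin; simpl.
      destruct (Rle_dec b z); destruct (Rle_dec b y);
        repeat destruct (Rle_dec a _); unfold Rabs;
        repeat destruct (Rcase_abs _); lra.
    - rewrite !Hin in Hm by lra. lra. }
  intros a b Ha Hb. destruct (Rtotal_order a b) as [Hab|[Hab|Hab]].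
  - exact (H a b Ha Hb Hab).
  - now rewrite Hab.
  - symmetry. exact (H b a Hb Ha Hab).
Qed.

(** In the frame rotating with angular velocity [k] a solution of
    [f' = k g, g' = - k f] has constant coordinates. *)
Lemma rotation_unique (T : R -> Prop) (t0 k : R) (f g : R -> R) :
  (forall x y z, T x -> T z -> x <= y <= z -> T y) -> T t0 ->
  continuous_on T f -> continuous_on T g ->
  (forall t, locally t T ->
     is_derive f t (k * g t) /\ is_derive g t (- (k * f t))) ->
  forall t, T t ->
    f t = f t0 * cos (k * (t - t0)) + g t0 * sin (k * (t - t0)) /\
    g t = g t0 * cos (k * (t - t0)) - f t0 * sin (k * (t - t0)).
Proof.
  intros HT Ht0 Hf Hg Hd t Ht.
  assert (Hcos : forall F : R -> R, (forall y, ex_derive F y) ->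
            continuous_on T (fun t => F (k * (t - t0)))).
  { intros F HF. apply continuous_on_comp; [|exact HF].
    apply differentiable_continuous_on. intros y. auto_derive. trivial. }
  assert (Hc : continuous_on T (fun t => cos (k * (t - t0)))).
  { apply Hcos. intros y. auto_derive. trivial. }
  assert (Hs : continuous_on T (fun t => sin (k * (t - t0)))).
  { apply Hcos. intros y. auto_derive. trivial. }
  assert (Hms : continuous_on T (fun t => - sin (k * (t - t0)))).
  { apply continuous_on_comp with (F := Ropp); [exact Hs|].
    intros y. auto_derive. trivial. }
  assert (H1 : f t * cos (k * (t - t0)) + g t * - sin (k * (t - t0)) = f t0).
  { transitivity (f t0 * cos (k * (t0 - t0)) + g t0 * - sin (k * (t0 - t0))).
    - apply (constant_on_interval T
               (fun t => f t * cos (k * (t - t0)) + g t * - sin (k * (t - t0))));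
        auto.
      + apply continuous_on_Rplus; apply continuous_on_Rmult; assumption.
      + intros y Hy. destruct (Hd y Hy) as [Df Dg].
        auto_derive; [repeat split; eexists; eassumption|].
        replace (Derive _ y) with (k * g y)
          by (symmetry; apply is_derive_unique; exact Df).
        replace (Derive _ y) with (- (k * f y))
          by (symmetry; apply is_derive_unique; exact Dg).
        ring.
    - replace (k * (t0 - t0)) with 0 by ring. rewrite cos_0, sin_0. ring. }
  assert (H2 : f t * sin (k * (t - t0)) + g t * cos (k * (t - t0)) = g t0).
  { transitivity (f t0 * sin (k * (t0 - t0)) + g t0 * cos (k * (t0 - t0))).
    - apply (constant_on_interval T
               (fun t => f t * sin (k * (t - t0)) + g t * cos (k * (t - t0))));
        auto.
      + apply continuous_on_Rplus; apply continuous_on_Rmult; assumption.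
      + intros y Hy. destruct (Hd y Hy) as [Df Dg].
        auto_derive; [repeat split; eexists; eassumption|].
        replace (Derive _ y) with (k * g y)
          by (symmetry; apply is_derive_unique; exact Df).
        replace (Derive _ y) with (- (k * f y))
          by (symmetry; apply is_derive_unique; exact Dg).
        ring.
    - replace (k * (t0 - t0)) with 0 by ring. rewrite cos_0, sin_0. ring. }
  pose proof (sin2_cos2 (k * (t - t0))) as Hu. unfold Rsqr in Hu.
  rewrite <- H1, <- H2.
  set (S := sin _) in *. set (D := cos _) in *.
  split.
  - transitivity (f t * (S * S + D * D)); [rewrite Hu|]; ring.
  - transitivity (g t * (S * S + D * D)); [rewrite Hu|]; ring.
Qed.

(** * Polar coordinates *)

Lemma polar_angle_spec (x y : R) :
  x = sqrt (x ^ 2 + y ^ 2) * cos (polar_angle x y) /\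
  y = sqrt (x ^ 2 + y ^ 2) * sin (polar_angle x y).
Proof.
  assert (Hq : x <> 0 -> sqrt (x ^ 2 + y ^ 2) = Rabs x * sqrt (1 + (y / x)²)).
  { intros Hx. rewrite <- sqrt_Rsqr_abs, <- sqrt_mult_alt by apply Rle_0_sqr.
    f_equal. unfold Rsqr. field. exact Hx. }
  assert (Hp : 0 < sqrt (1 + (y / x)²)).
  { apply sqrt_lt_R0. pose proof (Rle_0_sqr (y / x)). lra. }
  unfold polar_angle.
  destruct (Rlt_dec 0 x) as [Hx|Hx]; [|destruct (Rlt_dec x 0) as [Hx'|Hx']].
  - rewrite Hq, Rabs_right, cos_atan, sin_atan by lra. split; field; lra.
  - rewrite neg_cos, neg_sin, Hq, Rabs_left, cos_atan, sin_atan by lra.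
    split; field; lra.
  - replace x with 0 by lra. replace (0 ^ 2 + y ^ 2) with (y²) by (unfold Rsqr; ring).
    rewrite sqrt_Rsqr_abs. destruct (Rle_dec 0 y) as [Hy|Hy].
    + rewrite cos_PI2, sin_PI2, Rabs_right by lra. lra.
    + rewrite cos_neg, sin_neg, cos_PI2, sin_PI2, Rabs_left by lra. lra.
Qed.

(** The form in which the initial data enter: the left-hand sides are the
    values of a solution of the linear system after a turn by [ph]. *)
Lemma polar_rotate (x y ph : R) :
  let r := sqrt (x ^ 2 + y ^ 2) in
  x * cos ph + y * sin ph = r * cos (polar_angle x y - ph) /\
  y * cos ph - x * sin ph = r * sin (polar_angle x y - ph).
Proof.
  intros r. destruct (polar_angle_spec x y) as [Hx Hy]. fold r in Hx, Hy.
  rewrite cos_minus, sin_minus. set (th := polar_angle x y) in *.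
  split; rewrite Hx, Hy at 1; ring.
Qed.

(** * The linear system for the half-angle variables *)

Lemma sin_half_pos (p : R) : 0 < p < 2 * PI -> 0 < sin (p / 2).
Proof. intros H. apply sin_gt_0; lra. Qed.

Lemma sin_half_sqrt (p : R) :
  0 < p < 2 * PI -> sin (p / 2) = sqrt (1 - cos (p / 2) ^ 2).
Proof.
  intros H. pose proof (sin_half_pos p H) as Hs.
  pose proof (sin2_cos2 (p / 2)) as Hu. unfold Rsqr in Hu.
  symmetry. apply sqrt_lem_1; nra.
Qed.

Lemma is_derive_acos (x : R) : -1 < x < 1 ->
  is_derive acos x (- / sqrt (1 - x ^ 2)).
Proof.
  intros Hx. apply is_derive_Reals.
  replace (- / sqrt (1 - x ^ 2)) with (-1 / sqrt (1 - x²)).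
  { apply (derive_pt_eq_1 acos x _ (derivable_pt_acos x Hx)), derive_pt_acos. }
  replace (x²) with (x ^ 2) by (unfold Rsqr; ring). unfold Rdiv. ring.
Qed.

(** The factor [sin (p / 2)] absorbs the cotangent: the terms
    [cot (p / 2) Ai A3] of [Ai' sin (p / 2)] cancel against [Ai (sin (p / 2))'],
    as [p' = A3 omega]. *)
Lemma linear_of_system (omega t : R) (A1 A2 A3 p : R -> R) :
  0 < p t < 2 * PI ->
  cosserat_system omega A1 A2 A3 p t ->
  let k := / 2 * omega in
  is_derive (fun t => sin (p t / 2) * A1 t) t (k * (sin (p t / 2) * A2 t)) /\
  is_derive (fun t => sin (p t / 2) * A2 t) t (- (k * (sin (p t / 2) * A1 t))) /\
  is_derive (fun t => sin (p t / 2) * A3 t) t (k * cos (p t / 2)) /\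
  is_derive (fun t => cos (p t / 2)) t (- (k * (sin (p t / 2) * A3 t))).
Proof.
  intros Hp [[E1 [E2 [E3 Ep]]] [D1 [D2 [D3 Dp]]]] k.
  pose proof (sin_half_pos _ Hp) as Hs.
  assert (D1' : Derive A1 t = k * (A2 t - cot (p t / 2) * A1 t * A3 t))
    by (unfold k; lra).
  assert (D2' : Derive A2 t = k * (- A1 t - cot (p t / 2) * A2 t * A3 t))
    by (unfold k; lra).
  assert (D3' : Derive A3 t = k * (- cot (p t / 2) * (A3 t ^ 2 - 1)))
    by (unfold k; lra).
  assert (Dp' : Derive p t = 2 * k * A3 t) by (unfold k; lra).
  unfold cot in *.
  split; [|split; [|split]]; (auto_derive; [repeat split; assumption|]);
    rewrite ?(D1' : Derive (fun x => A1 x) t = _), ?(D2' : Derive (fun x => A2 x) t = _),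
      ?(D3' : Derive (fun x => A3 x) t = _), ?(Dp' : Derive (fun x => p x) t = _);
    change (p t * / 2) with (p t / 2); field; lra.
Qed.

(** Each quotient [qi / r], [r = sqrt (1 - q0 ^ 2)], has derivative
    [qi' / r - k q0 qi q3 / r ^ 3], whose second term is the cotangent term, as
    [q0 / r = cot (p / 2)].  The condition [q0 ^ 2 < 1] keeps [p] inside the
    branch, where [acos] is differentiable. *)
Lemma system_of_linear (k t : R) (q1 q2 q3 q0 : R -> R) :
  -1 < q0 t < 1 ->
  is_derive q1 t (k * q2 t) -> is_derive q2 t (- (k * q1 t)) ->
  is_derive q3 t (k * q0 t) -> is_derive q0 t (- (k * q3 t)) ->
  cosserat_system (2 * k)
    (fun t => q1 t / sqrt (1 - q0 t ^ 2)) (fun t => q2 t / sqrt (1 - q0 t ^ 2))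
    (fun t => q3 t / sqrt (1 - q0 t ^ 2)) (fun t => 2 * acos (q0 t)) t.
Proof.
  intros Hx D1 D2 D3 D0.
  assert (Hpos : 0 < 1 - q0 t ^ 2) by nra.
  pose proof (sqrt_lt_R0 _ Hpos) as Hr.
  pose proof (sqrt_sqrt _ (Rlt_le _ _ Hpos)) as Hrr.
  assert (Dq : forall (q : R -> R) (l : R), is_derive q t l ->
    is_derive (fun t : R => q t / sqrt (1 - q0 t ^ 2)) t
      (l / sqrt (1 - q0 t ^ 2)
       - k * q0 t * q t * q3 t / sqrt (1 - q0 t ^ 2) ^ 3)).
  { intros q l Dl. auto_derive.
    all: replace (1 + - (q0 t * (q0 t * 1))) with (1 - q0 t ^ 2) by ring.
    - repeat split; try (eexists; eassumption); lra.
    - replace (Derive (fun x => q x) t) with l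
        by (symmetry; apply is_derive_unique; exact Dl).
      replace (Derive (fun x => q0 x) t) with (- (k * q3 t))
        by (symmetry; apply is_derive_unique; exact D0).
      field. lra. }
  assert (Dp : is_derive (fun t : R => 2 * acos (q0 t)) t
                 (2 * (- (k * q3 t) * - / sqrt (1 - q0 t ^ 2)))).
  { apply is_derive_scal. 
    exact (is_derive_comp acos q0 t _ _ (is_derive_acos _ Hx) D0). }
  assert (Hcot : cot (2 * acos (q0 t) / 2) = q0 t / sqrt (1 - q0 t ^ 2)).
  { replace (2 * acos (q0 t) / 2) with (acos (q0 t)) by field. unfold cot.
    rewrite cos_acos, sin_acos by lra. unfold Rsqr.
    replace (q0 t * q0 t) with (q0 t ^ 2) by ring. reflexivity. }
  pose proof (Dq _ _ D1) as E1. pose proof (Dq _ _ D2) as E2.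
  pose proof (Dq _ _ D3) as E3.
  unfold cosserat_system. rewrite Hcot.
  rewrite (is_derive_unique _ _ _ E1), (is_derive_unique _ _ _ E2),
    (is_derive_unique _ _ _ E3), (is_derive_unique _ _ _ Dp).
  split; [repeat split; eexists; eassumption|].
  repeat split; field; lra.
Qed.

Lemma cosserat_system_ext (omega t : R) (A1 A2 A3 p B1 B2 B3 q : R -> R) :
  (forall t, A1 t = B1 t) -> (forall t, A2 t = B2 t) ->
  (forall t, A3 t = B3 t) -> (forall t, p t = q t) ->
  cosserat_system omega A1 A2 A3 p t -> cosserat_system omega B1 B2 B3 q t.
Proof.
  intros H1 H2 H3 H4 [[E1 [E2 [E3 Ep]]] Heq]. split.
  - repeat split; eapply ex_derive_ext; eassumption.
  - rewrite <- (Derive_ext _ _ t H1), <- (Derive_ext _ _ t H2),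
      <- (Derive_ext _ _ t H3), <- (Derive_ext _ _ t H4), <- H1, <- H2, <- H3, <- H4.
    exact Heq.
Qed.

(** * The explicit solution in half-angle variables *)

(** The half-angle variables of the explicit solution: the linear system is
    solved by circular motions whose squared radii [C / omega ^ 2] and
    [1 - C / omega ^ 2] add up to 1. *)
Definition sol_q1 (omega C C2 t : R) : R :=
  - (sqrt C / omega * sin (/ 2 * omega * (C2 - t))).

Definition sol_q2 (omega C C2 t : R) : R :=
  sqrt C / omega * cos (/ 2 * omega * (C2 - t)).

Definition sol_q3 (omega C C1 t : R) : R :=
  sqrt (omega ^ 2 - C) / omega * cos (/ 2 * omega * (C1 - t)).

Definition sol_q0 (omega C C1 t : R) : R :=
  sqrt (omega ^ 2 - C) / omega * sin (/ 2 * omega * (C1 - t)).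

Lemma sol_q_derive (omega C C1 C2 t : R) :
  let k := / 2 * omega in
  is_derive (sol_q1 omega C C2) t (k * sol_q2 omega C C2 t) /\
  is_derive (sol_q2 omega C C2) t (- (k * sol_q1 omega C C2 t)) /\
  is_derive (sol_q3 omega C C1) t (k * sol_q0 omega C C1 t) /\
  is_derive (sol_q0 omega C C1) t (- (k * sol_q3 omega C C1 t)).
Proof.
  intros k. unfold sol_q1, sol_q2, sol_q3, sol_q0, k.
  split; [|split; [|split]]; auto_derive; trivial; unfold Rminus, Rdiv; simpl; ring.
Qed.

Lemma den_sol_q0 (omega C C1 t : R) :
  0 < omega -> C <= omega ^ 2 ->
  den omega C C1 t = omega ^ 2 * (1 - sol_q0 omega C C1 t ^ 2).
Proof.
  intros Hw HC. unfold den, sol_q0.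
  set (th := / 2 * omega * (C1 - t)).
  pose proof (sin2_cos2 th) as Hu. unfold Rsqr in Hu.
  assert (Hr : sqrt (omega ^ 2 - C) * sqrt (omega ^ 2 - C) = omega ^ 2 - C)
    by (apply sqrt_sqrt; lra).
  transitivity (omega ^ 2
    - (sqrt (omega ^ 2 - C) * sqrt (omega ^ 2 - C)) * sin th ^ 2).
  - rewrite Hr. replace (cos th ^ 2) with (1 - sin th ^ 2) by lra. ring.
  - field. lra.
Qed.

(** The factor [omega] of [sqrt den] cancels the denominators of the radii.  The
    equalities for the [Ai] also hold where [den = 0], both sides being divided
    by 0. *)
Lemma sol_of_sol_q (omega C C1 C2 t : R) :
  0 < omega -> C <= omega ^ 2 ->
  let r := sqrt (1 - sol_q0 omega C C1 t ^ 2) in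
  sol_A1 omega C C1 C2 t = sol_q1 omega C C2 t / r /\
  sol_A2 omega C C1 C2 t = sol_q2 omega C C2 t / r /\
  sol_A3 omega C C1 t = sol_q3 omega C C1 t / r /\
  sol_p omega C C1 t = 2 * acos (sol_q0 omega C C1 t).
Proof.
  intros Hw HC r.
  assert (Hd : sqrt (den omega C C1 t) = omega * r).
  { unfold r. rewrite den_sol_q0 by assumption.
    rewrite sqrt_mult_alt by apply pow2_ge_0. rewrite sqrt_pow2 by lra.
    reflexivity. }
  unfold sol_A1, sol_A2, sol_A3, sol_p. rewrite Hd.
  unfold Rdiv. rewrite Rinv_mult.
  repeat split; unfold sol_q1, sol_q2, sol_q3, sol_q0, Rdiv; try ring.
  f_equal. f_equal. ring.
Qed.

Lemma sol_q_unit (omega C C1 C2 t : R) :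
  0 < omega -> 0 <= C <= omega ^ 2 ->
  sol_q1 omega C C2 t ^ 2 + sol_q2 omega C C2 t ^ 2 + sol_q3 omega C C1 t ^ 2
    + sol_q0 omega C C1 t ^ 2 = 1.
Proof.
  intros Hw HC. unfold sol_q1, sol_q2, sol_q3, sol_q0.
  set (th1 := / 2 * omega * (C1 - t)). set (th2 := / 2 * omega * (C2 - t)).
  pose proof (sin2_cos2 th1) as Hu1. pose proof (sin2_cos2 th2) as Hu2.
  unfold Rsqr in Hu1, Hu2.
  assert (Hr : sqrt (omega ^ 2 - C) * sqrt (omega ^ 2 - C) = omega ^ 2 - C)
    by (apply sqrt_sqrt; lra).
  assert (Hc : sqrt C * sqrt C = C) by (apply sqrt_sqrt; lra).
  transitivity (((sqrt C * sqrt C) * (sin th2 * sin th2 + cos th2 * cos th2)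
    + (sqrt (omega ^ 2 - C) * sqrt (omega ^ 2 - C))
      * (sin th1 * sin th1 + cos th1 * cos th1)) / omega ^ 2).
  - field. lra.
  - rewrite Hr, Hc, Hu1, Hu2. field. lra.
Qed.

(** Vanishing of [den] is exactly the degeneration [sin (p / 2) = 0]. *)
Lemma sol_q0_lt1 (omega C C1 t : R) :
  0 < omega -> 0 <= C <= omega ^ 2 -> den omega C C1 t <> 0 ->
  -1 < sol_q0 omega C C1 t < 1.
Proof.
  intros Hw HC Hd. rewrite den_sol_q0 in Hd by lra.
  pose proof (sol_q_unit omega C C1 0 t Hw HC) as Hu.
  set (q0 := sol_q0 omega C C1 t) in *.
  pose proof (pow2_ge_0 (sol_q1 omega C 0 t)).
  pose proof (pow2_ge_0 (sol_q2 omega C 0 t)).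
  pose proof (pow2_ge_0 (sol_q3 omega C C1 t)).
  assert (1 - q0 ^ 2 <> 0) by (intros E; apply Hd; rewrite E; ring).
  assert (0 < 1 - q0 ^ 2) by lra.
  split; nra.
Qed.

Lemma sol_admissible (omega C C1 C2 t : R) :
  0 < omega -> 0 <= C <= omega ^ 2 -> den omega C C1 t <> 0 ->
  admissible (sol_A1 omega C C1 C2 t) (sol_A2 omega C C1 C2 t)
    (sol_A3 omega C C1 t) (sol_p omega C C1 t).
Proof.
  intros Hw HC Hd.
  pose proof (sol_q0_lt1 omega C C1 t Hw HC Hd) as Hq.
  pose proof (sol_q_unit omega C C1 C2 t Hw HC) as Hu.
  destruct (sol_of_sol_q omega C C1 C2 t Hw (proj2 HC)) as [-> [-> [-> ->]]].
  set (q0 := sol_q0 omega C C1 t) in *.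
  assert (Hpos : 0 < 1 - q0 ^ 2) by nra.
  pose proof (sqrt_lt_R0 _ Hpos) as Hr.
  pose proof (sqrt_sqrt _ (Rlt_le _ _ Hpos)) as Hrr.
  split.
  - transitivity ((sol_q1 omega C C2 t ^ 2 + sol_q2 omega C C2 t ^ 2
      + sol_q3 omega C C1 t ^ 2) / (sqrt (1 - q0 ^ 2) * sqrt (1 - q0 ^ 2))).
    + field. lra.
    + rewrite Hrr. replace (_ + _ + _) with (1 - q0 ^ 2) by lra. field. lra.
  - pose proof (acos_bound_lt q0 Hq). lra.
Qed.

Lemma sol_cosserat_system (omega C C1 C2 t : R) :
  0 < omega -> 0 <= C <= omega ^ 2 -> den omega C C1 t <> 0 ->
  cosserat_system omega (sol_A1 omega C C1 C2) (sol_A2 omega C C1 C2)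
    (sol_A3 omega C C1) (sol_p omega C C1) t.
Proof.
  intros Hw HC Hd.
  destruct (sol_q_derive omega C C1 C2 t) as [D1 [D2 [D3 D0]]].
  pose proof (sol_q0_lt1 omega C C1 t Hw HC Hd) as Hq.
  pose proof (system_of_linear _ t _ _ _ _ Hq D1 D2 D3 D0) as HS.
  replace (2 * (/ 2 * omega)) with omega in HS by field.
  eapply cosserat_system_ext; [| | | |exact HS];
    intros y; symmetry; apply (sol_of_sol_q omega C C1 C2 y Hw (proj2 HC)).
Qed.

(** * Matching the initial data *)

Lemma const_C_bounds (omega a1 a2 a3 p0 : R) :
  admissible a1 a2 a3 p0 -> 0 <= const_C omega a3 p0 <= omega ^ 2.
Proof.
  intros [Hu _]. unfold const_C.
  pose proof (sin2_cos2 (p0 / 2)) as Hs. unfold Rsqr in Hs.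
  pose proof (pow2_ge_0 a1). pose proof (pow2_ge_0 a2). pose proof (pow2_ge_0 a3).
  pose proof (pow2_ge_0 (sin (p0 / 2))). pose proof (pow2_ge_0 (cos (p0 / 2))).
  pose proof (pow2_ge_0 omega).
  assert (0 <= (1 - a3 ^ 2) * sin (p0 / 2) ^ 2 <= 1) by (split; nra).
  rewrite Rmult_assoc. split; nra.
Qed.

(** The radii and phases of the explicit solution are polar coordinates of the
    initial values of the two pairs of half-angle variables.  For the first pair
    the positive common factor [sin (p0 / 2)] does not affect the angle. *)
Lemma sol_q_from_initial (omega t0 a1 a2 a3 p0 t : R) :
  0 < omega -> admissible a1 a2 a3 p0 ->
  let k := / 2 * omega in
  let C := const_C omega a3 p0 in
  let C1 := init_C1 omega t0 a3 p0 in
  let C2 := init_C2 omega t0 a1 a2 in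
  let s0 := sin (p0 / 2) in
  let c0 := cos (p0 / 2) in
  sol_q1 omega C C2 t
    = s0 * a1 * cos (k * (t - t0)) + s0 * a2 * sin (k * (t - t0)) /\
  sol_q2 omega C C2 t
    = s0 * a2 * cos (k * (t - t0)) - s0 * a1 * sin (k * (t - t0)) /\
  sol_q3 omega C C1 t
    = s0 * a3 * cos (k * (t - t0)) + c0 * sin (k * (t - t0)) /\
  sol_q0 omega C C1 t
    = c0 * cos (k * (t - t0)) - s0 * a3 * sin (k * (t - t0)).
Proof.
  intros Hw [Hu Hp] k C C1 C2 s0 c0.
  pose proof (sin_half_pos p0 Hp) as Hs. fold s0 in Hs.
  pose proof (sin2_cos2 (p0 / 2)) as Hsc. fold s0 c0 in Hsc. unfold Rsqr in Hsc.
  assert (Hr2 : sqrt C / omega = s0 * sqrt (a2 ^ 2 + (- a1) ^ 2)).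
  { replace C with ((omega * s0) ^ 2 * (a2 ^ 2 + (- a1) ^ 2)).
    - rewrite sqrt_mult_alt by apply pow2_ge_0.
      rewrite sqrt_pow2 by nra. field. lra.
    - unfold C, const_C. fold s0. replace (1 - a3 ^ 2) with (a1 ^ 2 + a2 ^ 2) by lra.
      ring. }
  assert (Hr1 : sqrt (omega ^ 2 - C) / omega = sqrt ((a3 * s0) ^ 2 + c0 ^ 2)).
  { replace (omega ^ 2 - C) with (omega ^ 2 * ((a3 * s0) ^ 2 + c0 ^ 2)).
    - rewrite sqrt_mult_alt by apply pow2_ge_0.
      rewrite sqrt_pow2 by lra. field. lra.
    - unfold C, const_C. fold s0. replace (c0 ^ 2) with (1 - s0 ^ 2) by lra. ring. }
  assert (Ha1 : / 2 * omega * (C1 - t) = polar_angle (a3 * s0) c0 - k * (t - t0)).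
  { unfold C1, init_C1, k. fold s0 c0. field. lra. }
  assert (Ha2 : / 2 * omega * (C2 - t) = polar_angle a2 (- a1) - k * (t - t0)).
  { unfold C2, init_C2, k. field. lra. }
  unfold sol_q1, sol_q2, sol_q3, sol_q0. rewrite Hr1, Hr2, Ha1, Ha2.
  rewrite !(Rmult_assoc s0 (sqrt _)).
  destruct (polar_rotate a2 (- a1) (k * (t - t0))) as [<- <-].
  destruct (polar_rotate (a3 * s0) c0 (k * (t - t0))) as [<- <-].
  repeat split; ring.
Qed.

(** On the branch [0 < p < 2 PI] the half-angle variables determine the angle
    and the axis, since [sin (p / 2)] is the positive root of [1 - q0 ^ 2]. *)
Lemma sol_unique_of_half_angle (omega C C1 C2 t a1 a2 a3 p : R) :
  0 < omega -> C <= omega ^ 2 -> 0 < p < 2 * PI ->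
  sin (p / 2) * a1 = sol_q1 omega C C2 t ->
  sin (p / 2) * a2 = sol_q2 omega C C2 t ->
  sin (p / 2) * a3 = sol_q3 omega C C1 t ->
  cos (p / 2) = sol_q0 omega C C1 t ->
  a1 = sol_A1 omega C C1 C2 t /\ a2 = sol_A2 omega C C1 C2 t /\
  a3 = sol_A3 omega C C1 t /\ p = sol_p omega C C1 t.
Proof.
  intros Hw HC Hp E1 E2 E3 E0.
  pose proof (sin_half_pos p Hp) as Hs.
  destruct (sol_of_sol_q omega C C1 C2 t Hw HC) as [-> [-> [-> ->]]].
  rewrite <- E0, <- E1, <- E2, <- E3, <- sin_half_sqrt, acos_cos by lra.
  repeat split; field; lra.
Qed.

(** The system holds only in the interior of [T]; the continuity hypotheses,
    passed on to the half-angle variables, carry the formulas to the end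
    points. *)
Lemma general_solution (omega t0 : R) (T : R -> Prop) (A1 A2 A3 p : R -> R) :
  0 < omega ->
  (forall x y z : R, T x -> T z -> x <= y <= z -> T y) -> T t0 ->
  (forall t, T t -> admissible (A1 t) (A2 t) (A3 t) (p t)) ->
  continuous_on T A1 -> continuous_on T A2 ->
  continuous_on T A3 -> continuous_on T p ->
  (forall t, locally t T -> cosserat_system omega A1 A2 A3 p t) ->
  let C := const_C omega (A3 t0) (p t0) in
  let C1 := init_C1 omega t0 (A3 t0) (p t0) in
  let C2 := init_C2 omega t0 (A1 t0) (A2 t0) in
  forall t, T t ->
    A1 t = sol_A1 omega C C1 C2 t /\ A2 t = sol_A2 omega C C1 C2 t /\
    A3 t = sol_A3 omega C C1 t /\ p t = sol_p omega C C1 t.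
Proof.
  intros Hw HT Ht0 Hadm H1 H2 H3 Hp Hsys C C1 C2 t Ht.
  assert (Hlin := fun y Hy =>
    linear_of_system omega y A1 A2 A3 p
      (proj2 (Hadm y (locally_singleton _ _ Hy))) (Hsys y Hy)).
  assert (Hs : continuous_on T (fun t => sin (p t / 2))).
  { apply continuous_on_comp with (F := fun y => sin (y / 2)); [exact Hp|].
    intros y. auto_derive. trivial. }
  assert (Hc : continuous_on T (fun t => cos (p t / 2))).
  { apply continuous_on_comp with (F := fun y => cos (y / 2)); [exact Hp|].
    intros y. auto_derive. trivial. }
  destruct (rotation_unique T t0 (/ 2 * omega)
    (fun t => sin (p t / 2) * A1 t) (fun t => sin (p t / 2) * A2 t)
    HT Ht0 (continuous_on_Rmult _ _ _ Hs H1) (continuous_on_Rmult _ _ _ Hs H2)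
    (fun y Hy => conj (proj1 (Hlin y Hy)) (proj1 (proj2 (Hlin y Hy)))) t Ht)
    as [E1 E2].
  destruct (rotation_unique T t0 (/ 2 * omega)
    (fun t => sin (p t / 2) * A3 t) (fun t => cos (p t / 2))
    HT Ht0 (continuous_on_Rmult _ _ _ Hs H3) Hc
    (fun y Hy => proj2 (proj2 (Hlin y Hy))) t Ht)
    as [E3 E0].
  destruct (sol_q_from_initial omega t0 _ _ _ _ t Hw (Hadm t0 Ht0))
    as [F1 [F2 [F3 F0]]].
  apply sol_unique_of_half_angle.
  - exact Hw.
  - apply (const_C_bounds omega _ _ _ _ (Hadm t0 Ht0)).
  - exact (proj2 (Hadm t Ht)).
  - exact (eq_trans E1 (eq_sym F1)).
  - exact (eq_trans E2 (eq_sym F2)).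
  - exact (eq_trans E3 (eq_sym F3)).
  - exact (eq_trans E0 (eq_sym F0)).
Qed.

(** * General solution of the nonlinear system *)

Theorem mainTheorem2 :
  forall (rod : R -> Prop) (w1 w2 w3 : R -> R) (t0 : R),
  let omega := twist_norm w1 w2 w3 in
  (forall s : R, rod s -> 0 < omega s) ->
  (* solutions, for arbitrary functions C, C1, C2 of s *)
  (forall C C1 C2 : R -> R,
    (forall s : R, rod s -> 0 <= C s <= omega s ^ 2) ->
    forall s t : R, rod s -> den (omega s) (C s) (C1 s) t <> 0 ->
      admissible (sol_A1 (omega s) (C s) (C1 s) (C2 s) t)
                 (sol_A2 (omega s) (C s) (C1 s) (C2 s) t)
                 (sol_A3 (omega s) (C s) (C1 s) t)
                 (sol_p (omega s) (C s) (C1 s) t) /\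
      cosserat_system (omega s)
        (sol_A1 (omega s) (C s) (C1 s) (C2 s))
        (sol_A2 (omega s) (C s) (C1 s) (C2 s))
        (sol_A3 (omega s) (C s) (C1 s))
        (sol_p (omega s) (C s) (C1 s)) t) /\
  (* in particular for the printed C, C1, C2 computed from initial data *)
  (forall a1 a2 a3 p0 : R -> R,
    (forall s : R, rod s -> admissible (a1 s) (a2 s) (a3 s) (p0 s)) ->
    let C := fun s => const_C (omega s) (a3 s) (p0 s) in
    let C1 := fun s => printed_C1 (omega s) t0 (a3 s) (p0 s) in
    let C2 := fun s => printed_C2 (omega s) t0 (a1 s) (a2 s) in
    forall s t : R, rod s -> den (omega s) (C s) (C1 s) t <> 0 ->
      cosserat_system (omega s)
        (sol_A1 (omega s) (C s) (C1 s) (C2 s))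
        (sol_A2 (omega s) (C s) (C1 s) (C2 s))
        (sol_A3 (omega s) (C s) (C1 s))
        (sol_p (omega s) (C s) (C1 s)) t) /\
  (* every solution on a time interval containing t0 is of this form, with
     C, C1, C2 determined by its values at t0 *)
  (forall (T : R -> Prop) (A1 A2 A3 p : R -> R -> R),
    (forall x y z : R, T x -> T z -> x <= y <= z -> T y) ->
    T t0 ->
    (forall s t : R, rod s -> T t ->
      admissible (A1 s t) (A2 s t) (A3 s t) (p s t)) ->
    (forall s : R, rod s ->
      continuous_on T (A1 s) /\ continuous_on T (A2 s) /\
      continuous_on T (A3 s) /\ continuous_on T (p s)) ->
    (forall s t : R, rod s -> locally t T ->
      cosserat_system (omega s) (A1 s) (A2 s) (A3 s) (p s) t) ->
    let C := fun s => const_C (omega s) (A3 s t0) (p s t0) in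
    let C1 := fun s => init_C1 (omega s) t0 (A3 s t0) (p s t0) in
    let C2 := fun s => init_C2 (omega s) t0 (A1 s t0) (A2 s t0) in
    forall s t : R, rod s -> T t ->
      A1 s t = sol_A1 (omega s) (C s) (C1 s) (C2 s) t /\
      A2 s t = sol_A2 (omega s) (C s) (C1 s) (C2 s) t /\
      A3 s t = sol_A3 (omega s) (C s) (C1 s) t /\
      p s t = sol_p (omega s) (C s) (C1 s) t).
Proof.
  intros rod w1 w2 w3 t0 omega Hw. split; [|split].
  - intros C C1 C2 HC s t Hs Hd. split.
    + exact (sol_admissible _ _ _ _ _ (Hw s Hs) (HC s Hs) Hd).
    + exact (sol_cosserat_system _ _ _ _ _ (Hw s Hs) (HC s Hs) Hd).
  - intros a1 a2 a3 p0 Hadm C C1 C2 s t Hs Hd.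
    exact (sol_cosserat_system _ _ _ _ _ (Hw s Hs)
             (const_C_bounds _ _ _ _ _ (Hadm s Hs)) Hd).
  - intros T A1 A2 A3 p HT Ht0 Hadm Hcont Hsys C C1 C2 s t Hs Ht.
    destruct (Hcont s Hs) as [H1 [H2 [H3 Hp]]].
    exact (general_solution (omega s) t0 T (A1 s) (A2 s) (A3 s) (p s) (Hw s Hs)
             HT Ht0 (fun t => Hadm s t Hs) H1 H2 H3 Hp
             (fun t => Hsys s t Hs) t Ht).
Qed.
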